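(* Let $n\in\mathbb{N}$ with $n\geq 2$, and define $$\bar{\alpha}:=\frac{\sqrt{n^2+4}-n}{2},\qquad \gamma:=\frac{1}{\bar{\alpha}+n},\qquad \tau:=\frac{\log(\bar{\alpha}+n)}{\log n}.$$ Then $\bar{\alpha}$ is an isolated point of $D_{\gamma,\tau}$.
   Context: $\mathbb{N}=\{1,2,3,\dots\}$. For $x\in\mathbb{R}$, $\|x\|:=\min_{p\in\mathbb{Z}}|x-p|$. For $\gamma>0$ and $\tau\geq 1$, $$D_{\gamma,\tau}:=\{\alpha\in(0,1): \|q\alpha\|\geq \gamma/q^{\tau}\ \text{ for all } q\in\mathbb{N}\}.$$ Isolated points are taken with respect to the topology induced from $\mathbb{R}$. *)

(* Defs.v *)
From mathcomp Require Import all_boot all_order all_algebra.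
From mathcomp Require Import all_classical all_reals all_analysis.

Set Implicit Arguments.
Unset Strict Implicit.
Unset Printing Implicit Defensive.

Import Order.TTheory GRing.Theory Num.Theory.
Import numFieldNormedType.Exports.

Local Open Scope classical_set_scope.
Local Open Scope ring_scope.

(* The infimum is a minimum: see [dist_int_min]. *)
Definition dist_int (R : realType) (x : R) : R :=
  inf [set `|x - p%:~R| | p in [set: int]].

Lemma dist_int_min (R : realType) (x : R) :
  (exists p : int, dist_int x = `|x - p%:~R|) /\
  (forall p : int, dist_int x <= `|x - p%:~R|).
Proof.
have lbd : has_lbound [set `|x - p%:~R| | p in [set: int]].
  by exists 0 => _ [p _ <-].
have le p : dist_int x <= `|x - p%:~R| by apply: ge_inf => //; exists p.
split=> //.
pose f := Num.floor x.
have /andP[fx xf] : f%:~R <= x < (f + 1)%:~R by exact: floor_itv.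
pose m := Num.min `|x - f%:~R| `|x - (f + 1)%:~R|.
have mle p : m <= `|x - p%:~R|.
  rewrite ge_min; have [pf|fp] := leP p f; apply/orP; [left|right].
    have pf' : p%:~R <= f%:~R :> R by rewrite ler_int.
    by rewrite !ger0_norm ?subr_ge0 ?(le_trans pf' fx)// lerD2l lerN2.
  have fp' : (f + 1)%:~R <= p%:~R :> R by rewrite ler_int lezD1.
  rewrite ![`|x - _|]distrC !ger0_norm ?subr_ge0 ?lerD2r// ltW//.
  exact: lt_le_trans fp'.
have mE : dist_int x = m.
  apply/eqP; rewrite eq_le le_min !le /=.
  by apply: lb_le_inf => [|_ [p _ <-]//]; exists `|x - 0%:~R|, 0.
by rewrite mE /m; case: leP => _; [exists f | exists (f + 1)].
Qed.

(* Intended for 0 < gamma and 1 <= tau; the expression is total in both. *)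
Definition diophantine_set (R : realType) (gamma tau : R) : set R :=
  [set alpha | 0 < alpha < 1 /\
     forall q : nat, (0 < q)%N ->
       gamma / (q%:R `^ tau) <= dist_int (q%:R * alpha)].

(* Main.v *)
Require Import Defs.
From mathcomp Require Import all_boot all_order all_algebra.
From mathcomp Require Import all_classical all_reals all_analysis.
From mathcomp Require Import ring lra.

Import Order.TTheory GRing.Theory Num.Theory.
Import numFieldNormedType.Exports.

Local Open Scope classical_set_scope.
Local Open Scope ring_scope.

(** The number alpha is the positive root of x^2 + n x = 1, so that
    gamma = 1 / (alpha + n) = alpha and n^tau = alpha + n = 1 / alpha.

    With these values the inequality ||q x|| >= gamma / q^tau is tight at
    x = alpha for the two denominators q = 1 and q = n, the first two
    denominators of convergents of alpha = [0; n, n, n, ...]: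
    ||alpha|| = alpha = gamma and ||n alpha|| = 1 - n alpha = alpha^2
    = gamma / n^tau.  Since 0 < alpha < 1/n, alpha is above the integer 0 and
    n alpha is below the integer 1.  So for x close to alpha the case q = 1
    forces x >= alpha, while the case q = n forces x <= alpha
    ([diophantine_set_eq_near]).

    It remains to see that alpha itself belongs to the set, i.e. that
    |q alpha - p| q^tau >= alpha for all q > 0 and all integers p
    ([quadratic_root_approx]).  The defining equation makes the set of
    approximations self-similar: |p alpha - (q - n p)| = |q alpha - p| / alpha,
    so that replacing (q, p) by (p, q - n p), one step of the Euclidean
    algorithm, divides the error by alpha.  This descent applies when p > 0 and
    n p <= q, and then q^tau >= n^tau p^tau = p^tau / alpha, exactly the factor
    that is lost.  In all other cases |q alpha - p| >= alpha outright. *)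

(** Induction on [q], along the descent from (q, p) to (p, q - n p). *)
Lemma quadratic_root_approx (R : realType) (n : nat) (a tau : R) :
    (1 < n)%N -> 0 < a -> a ^+ 2 + n%:R * a = 1 -> 0 <= tau ->
    a * n%:R `^ tau = 1 ->
  forall (q : nat) (p : int), (0 < q)%N ->
    a <= `|q%:R * a - p%:~R| * q%:R `^ tau.
Proof.
move=> n1 a0 aE tau0 ntau; elim/ltn_ind => q IH p q0.
have q1 : 1 <= q%:R :> R by rewrite ler1n.
have qtau : 1 <= q%:R `^ tau by have := ler_powR q1 tau0; rewrite powRr0.
have coarse : a <= `|q%:R * a - p%:~R| -> a <= `|q%:R * a - p%:~R| * q%:R `^ tau.
  by move=> /le_trans; apply; rewrite ler_peMr.
have [p0|p0] := lerP p 0.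
  apply: coarse; have pR : p%:~R <= 0 :> R by rewrite lerz0.
  apply: le_trans (ler_norm _).
  have : a <= q%:R * a by rewrite ler_peMl // ltW.
  lra.
case: p p0 coarse => // m m0 coarse; rewrite -pmulrn in coarse *.
have {}m0 : (0 < m)%N by [].
have m1 : 1 <= m%:R :> R by rewrite ler1n.
have [nmq|qnm] := leqP (n * m) q.
  have mq : (m < q)%N by apply: leq_trans nmq; rewrite ltn_Pmull.
  have := IH m mq (q%:Z - (n * m)%:Z) m0.
  have -> : m%:R * a - (q%:Z - (n * m)%:Z)%:~R = - (q%:R * a - m%:R) / a :> R.
    rewrite intrB -!pmulrn natrM; apply: (mulIf (lt0r_neq0 a0)).
    rewrite divfK ?lt0r_neq0 //.
    have -> : (m%:R * a - (q%:R - n%:R * m%:R)) * a =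
       m%:R * (a ^+ 2 + n%:R * a) - q%:R * a :> R by ring.
    by rewrite aE; ring.
  rewrite normrM normrN normfV (gtr0_norm a0) => IHm.
  apply: (le_trans IHm); rewrite -mulrA ler_wpM2l //.
  have -> : a^-1 = n%:R `^ tau.
    by apply: (mulfI (lt0r_neq0 a0)); rewrite ntau divff ?lt0r_neq0.
  rewrite -powRM ?ler0n // -natrM ge0_ler_powR ?nnegrE ?ler0n //.
  by rewrite ler_nat.
(* Here q <= n m - 1, so that m - q a >= m (1 - n a) + a = m a^2 + a. *)
apply: coarse; rewrite distrC; apply: le_trans (ler_norm _).
have qa : (q%:R + 1) * a <= n%:R * m%:R * a :> R.
  by rewrite ler_wpM2r ?(ltW a0) // natr1 -natrM ler_nat.
have : 0 <= m%:R * a ^+ 2 by rewrite mulr_ge0 ?sqr_ge0.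
have : n%:R * m%:R * a = m%:R - m%:R * a ^+ 2.
  have na : n%:R * a = 1 - a ^+ 2 by lra.
  by rewrite mulrAC na; ring.
lra.
Qed.

(** The constraint at q = 1 bounds [x] from below, since [x] exceeds the integer
    0; the one at q = n bounds it from above, since [n x] is below the integer
    1. *)
Lemma diophantine_set_eq_near (R : realType) (n : nat) (a tau x : R) :
    (0 < n)%N -> 0 < a -> a ^+ 2 + n%:R * a = 1 -> a * n%:R `^ tau = 1 ->
    n%:R * x < 1 -> diophantine_set a tau x ->
  x = a.
Proof.
move=> n0 a0 aE ntau nx [/andP[x0 _] xD].
have nR : 0 < n%:R :> R by rewrite ltr0n.
apply/eqP; rewrite eq_le; apply/andP; split.
  have := le_trans (xD n n0) ((dist_int_min (n%:R * x)).2 1).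
  have -> : a / n%:R `^ tau = a ^+ 2.
    apply: (mulIf (lt0r_neq0 (powR_gt0 tau nR))).
    by rewrite divfK ?lt0r_neq0 ?powR_gt0 // expr2 -mulrA ntau mulr1.
  rewrite mulr1z distrC ger0_norm; last by rewrite subr_ge0 ltW.
  by move=> nxa; rewrite -(ler_pM2l nR); lra.
have := le_trans (xD 1%N isT) ((dist_int_min (1%:R * x)).2 0).
by rewrite powR1 divr1 mul1r subr0 gtr0_norm.
Qed.

Theorem proposition1 (R : realType) (n : nat) (hn : (2 <= n)%N) :
  let alpha : R := (Num.sqrt (n%:R ^+ 2 + 4) - n%:R) / 2 in
  let gamma : R := 1 / (alpha + n%:R) in
  let tau : R := ln (alpha + n%:R) / ln n%:R in
  isolated (diophantine_set gamma tau) alpha.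
Proof.
move=> a gamma tau.
have n2 : 2 <= n%:R :> R by rewrite ler_nat.
have n0 : 0 < n%:R :> R by lra.
have aE : a ^+ 2 + n%:R * a = 1.
  have : Num.sqrt (n%:R ^+ 2 + 4) ^+ 2 = n%:R ^+ 2 + 4 :> R.
    by rewrite sqr_sqrtr // addr_ge0 ?sqr_ge0.
  rewrite /a; move: (Num.sqrt _) => s sE.
  have -> : ((s - n%:R) / 2) ^+ 2 + n%:R * ((s - n%:R) / 2) =
            (s ^+ 2 - n%:R ^+ 2) / 4 by field.
  by rewrite sE; field.
have a0 : 0 < a.
  rewrite divr_gt0 // subr_gt0 -[ltLHS](ger0_norm (ltW n0)) -sqrtr_sqr.
  by rewrite ltr_sqrt ?ltrDl // addr_gt0 // exprn_gt0.
have na1 : n%:R * a < 1 by have := exprn_gt0 2 a0; lra.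
have a1 : a < 1.
  by apply: le_lt_trans na1; rewrite ler_peMl ?(ltW a0) //; lra.
have aVE : a * (a + n%:R) = 1 by rewrite mulrDr -expr2 [a * n%:R]mulrC.
have gammaE : gamma = a.
  rewrite /gamma; apply: (mulIf (lt0r_neq0 (addr_gt0 a0 n0))).
  by rewrite divfK ?lt0r_neq0 ?addr_gt0.
have lnn : 0 < ln n%:R :> R by rewrite ln_gt0 //; lra.
have tau0 : 0 <= tau by rewrite divr_ge0 ?ltW // ln_gt0 //; lra.
have ntau : a * n%:R `^ tau = 1.
  by rewrite /powR gt_eqF // /tau divfK ?lt0r_neq0 // lnK ?posrE ?addr_gt0.
have aD : diophantine_set a tau a.
  split=> [|q q0]; first by rewrite a0.
  have [[p ->] _] := dist_int_min (q%:R * a).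
  rewrite ler_pdivrMr ?powR_gt0 ?ltr0n //.
  exact: (quadratic_root_approx _ _ _ _ hn a0 aE tau0 ntau).
rewrite gammaE; split; first exact/mem_set.
exists [set x | x < n%:R^-1].
  by apply: lt_nbhsl; rewrite -div1r ltr_pdivlMr // mulrC.
apply/seteqP; split=> [x [/= xn xD]|_ -> /=].
  apply: (@diophantine_set_eq_near _ n a tau) => //; first exact: ltnW.
  by rewrite mulrC -ltr_pdivlMr // div1r.
by split=> //; rewrite -div1r ltr_pdivlMr // mulrC.
Qed.
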